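(* For every pattern $\tau\in\{12312,\,12132,\,12123,\,12321,\,12231,\,12213\}$ and every $n\ge1$, the number of matchings on $[2n]$ avoiding $\tau$ equals $C_{n,3}=\frac{1}{2n+1}\binom{3n}{n}$.
   Context: A matching on $[2n]$ is a partition of $[2n]$ into $n$ blocks of size two (edges). The canonical sequential form of a matching with $n$ edges is the word of length $2n$ obtained by labeling edges $1,\dots,n$ in increasing order of their smaller elements and writing at each position the label of the edge containing it. Words $a_1\cdots a_k$, $b_1\cdots b_k$ are order-isomorphic if $a_i<a_j\iff b_i<b_j$ for all $i,j$. A matching contains a pattern $\tau$ if its canonical sequential form has a subsequence order-isomorphic to $\tau$, and avoids $\tau$ otherwise. *)

(* Defs.v *)
From mathcomp Require Import all_boot all_order all_algebra.

Set Implicit Arguments.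
Unset Strict Implicit.
Unset Printing Implicit Defensive.

(* The ground set [2n] = {1, ..., 2n} is represented by 'I_(2 * n), with      *)
(* i : 'I_(2 * n) standing for i + 1.                                         *)
Definition is_matching (n : nat) (M : {set {set 'I_(2 * n)}}) : bool :=
  partition M [set: 'I_(2 * n)] && [forall (B | B \in M), #|B| == 2].

(* The default value m is never reached when B is nonempty. *)
Definition set_min (m : nat) (B : {set 'I_m}) : nat :=
  \big[minn/m]_(i in B) (i : nat).

(* Rank of the edge B when the edges of M are numbered 1, 2, ... in           *)
(* increasing order of their smaller elements; B itself is counted.           *)
Definition edge_label (m : nat) (M : {set {set 'I_m}}) (B : {set 'I_m}) : nat :=
  #|[set B' in M | set_min B' <= set_min B]|.

Definition canonical_form (m : nat) (M : {set {set 'I_m}}) : seq nat :=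
  [seq edge_label M (pblock M i) | i <- enum 'I_m].

Definition order_iso (a b : seq nat) : bool :=
  (size a == size b) &&
  [forall i : 'I_(size a), forall j : 'I_(size a),
     (nth 0 a i < nth 0 a j) == (nth 0 b i < nth 0 b j)].

(* The subsequences of w are the words mask s w for s : (size w).-tuple bool. *)
Definition word_contains (w tau : seq nat) : bool :=
  [exists s : (size w).-tuple bool, order_iso (mask s w) tau].

Definition matching_avoids (m : nat) (M : {set {set 'I_m}}) (tau : seq nat)
    : bool :=
  ~~ word_contains (canonical_form M) tau.

Definition avoiding_matchings (n : nat) (tau : seq nat)
    : {set {set {set 'I_(2 * n)}}} :=
  [set M | is_matching M && matching_avoids M tau].

(* Main.v *)
Require Import Defs.
From mathcomp Require Import all_boot all_order all_algebra zify.

(** Every pattern contains the letter 3 once, so write it u 3 v with u and v in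
    the letters 1, 2. A canonical word with n + 1 edges arises from one with n
    edges by inserting the new largest letter N twice, at two gaps p <= q that
    lie after all first occurrences. Being largest, N can only play the role of
    3; hence the new word avoids the pattern iff the old one does and neither p
    nor q is a gap with some copy of u to its left and the matching copy of v to
    its right. Call the remaining gaps open.

    For each of the six patterns, among the choices p <= q of two of the K open
    gaps exactly K - d produce a word with d + 2 open gaps (d < K), although the
    correspondence differs from pattern to pattern. So all six classes have the
    same generating tree, and the number of its nodes at level n having k + 1
    open gaps is the coefficient of z^(n - k) in T^(2k), where T = 1 + z T^3.
    Summing over k gives the coefficient of z^n in T. *)

Set Implicit Arguments.
Unset Strict Implicit.
Unset Printing Implicit Defensive.

Import Order.TTheory.

(** * Powers of the ternary tree series *)

(* [raney j r] is the coefficient of z^j in T^r, where T = 1 + z T^3; the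
   recursion is T^(r+1) = T^r + z T^(r+3). *)
Fixpoint raney (j : nat) : nat -> nat :=
  match j with
  | 0 => fun=> 1
  | j'.+1 => fix rj r := if r is r'.+1 then rj r' + raney j' r.+2 else 0
  end.

Lemma raneySS j r : raney j.+1 r.+1 = raney j.+1 r + raney j r.+3.
Proof. by []. Qed.

(* T^(r+1) = T^r / (1 - z T^2). *)
Lemma raney_geometric m r :
  raney m r.+1 = \sum_(t < m.+1) raney (m - t) (r + 2 * t).
Proof.
elim: m r => [|m IHm] r; first by rewrite big_ord1.
rewrite raneySS big_ord_recl subn0 addn0 IHm; congr (_ + _).
by apply: eq_bigr => t _; rewrite lift0 subSS; congr raney; lia.
Qed.

(* T^(r+2) = T^r / (1 - z T^2)^2. *)
Lemma raney_geometric2 m r :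
  raney m r.+2 = \sum_(t < m.+1) t.+1 * raney (m - t) (r + 2 * t).
Proof.
elim: m r => [|m IHm] r; first by rewrite big_ord1.
rewrite 2!raneySS big_ord_recl subn0 addn0 mul1n -addnA; congr (_ + _).
rewrite (IHm r.+2) (raney_geometric m r.+2) addnC -big_split.
apply: eq_bigr => t _; rewrite lift0 subSS [in RHS]mulSn.
by rewrite (_ : r + 2 * t.+1 = r.+2 + 2 * t) /= 1?addnC //; lia.
Qed.

Lemma raney_bin j r :
  raney j.+1 r.+1 + 2 * 'C(3 * j.+1 + r, j) = 'C(3 * j.+1 + r, j.+1).
Proof.
elim: j r => [|j IHj] r.
  by rewrite bin0 bin1; elim: r => [|r IHr] //;
    rewrite raneySS [raney 0 _]/=; lia.
elim: r => [|r IHr].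
  have bin_pred : 'C((3 * j.+2).-1, j.+2) = 2 * 'C((3 * j.+2).-1, j.+1).
    apply/eqP; rewrite -(eqn_pmul2l (isT : 0 < j.+2)) mul_bin_left.
    by apply/eqP; rewrite (_ : _ - _ = j.+2 * 2) ?mulnA //; lia.
  have := IHj 2; rewrite (raneySS j.+1) addn0.
  rewrite (_ : 3 * j.+2 = (3 * j.+1 + 2).+1) in bin_pred *; last by lia.
  by move: (3 * j.+1 + 2) bin_pred => m /= bin_pred;
    rewrite !binS bin_pred; lia.
have IHj3 := IHj r.+3; have shift : 3 * j.+2 + r = 3 * j.+1 + r.+3 by lia.
rewrite raneySS (addnS (3 * j.+2)) shift; rewrite shift in IHr.
by move: (3 * j.+1 + r.+3) IHr IHj3 => m IHr IHj3; rewrite !binS; lia.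
Qed.

Lemma raney1_bin n : (2 * n + 1) * raney n 1 = 'C(3 * n, n).
Proof.
case: n => [|n]; first by rewrite bin0.
have := raney_bin n 0; rewrite addn0.
have := mul_bin_left (3 * n.+1) n.
rewrite (_ : 3 * n.+1 - n = 2 * n.+1 + 1); last by lia.
nia.
Qed.

Lemma sum_raney_triangle n (h : nat -> nat) :
  \sum_(k < n.+1) raney (n - k) (2 * k) * \sum_(d < k.+1) (k.+1 - d) * h d =
  \sum_(d < n.+1) raney (n - d) (2 * d).+2 * h d.
Proof.
pose F k d := raney (n - k) (2 * k) * ((k.+1 - d) * h d).
transitivity (\sum_(0 <= k < n.+1) \sum_(0 <= d < n.+1 | d <= k) F k d).
  rewrite big_mkord; apply: eq_bigr => k _; rewrite big_distrr /= big_mkord.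
  exact: (big_ord_widen n.+1 (F k)).
rewrite (exchange_big_dep xpredT) //= big_mkord; apply: eq_bigr => d _.
have dn := ltn_ord d; rewrite raney_geometric2 big_distrl /=.
rewrite (big_cat_nat _ (n := d)) //=; last by lia.
rewrite big_nat_cond big_pred0 ?add0n; last by move=> k; lia.
rewrite -{1}[nat_of_ord d]add0n big_addn subSn // big_nat_cond.
rewrite -(big_mkord xpredT (fun t => t.+1 * _ (n - d - t) (_ + 2 * t) * _)).
rewrite [RHS]big_nat_cond; apply: eq_big => [t|t _]; first by lia.
rewrite /F.
have -> : (t + d).+1 - d = t.+1 by lia.
have [-> ->] : n - (t + d) = n - d - t /\ 2 * (t + d) = 2 * d + 2 * t by lia.
by rewrite mulnA (mulnC t.+1).
Qed.

(** * Subsequences of words with a marked letter *)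

Section MarkedLetter.

Variables (T : eqType) (N : T).
Implicit Types s r x y z : seq T.

Lemma filter_predC1_id s : N \notin s -> filter (predC1 N) s = s.
Proof.
by move=> Ns; apply/all_filterP/allP => a sa /=; apply: contraNneq Ns => <-.
Qed.

Lemma subseq_filter_predC1 s x :
  N \notin s -> subseq s (filter (predC1 N) x) = subseq s x.
Proof.
by move=> Ns; rewrite subseq_filter -[X in all _ X]filter_predC1_id ?filter_all.
Qed.

Lemma subseq_pivot s r x y : N \notin x -> N \notin s ->
  subseq (s ++ N :: r) (x ++ N :: y) =
  subseq s x && subseq r y || subseq (s ++ N :: r) (x ++ y).
Proof.
elim: x s => [|b x IHx] [|a s] Nx Ns.
- rewrite /= eqxx; apply/idP/orP => [->|[//|]]; first by left.
  exact/subseq_trans/subseq_cons.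
- by move: Ns; rewrite /= inE negb_or eq_sym => /andP [/negPf ->].
- move: Nx; rewrite /= inE negb_or => /andP [/negPf -> Nx].
  by rewrite -[N :: r]/([::] ++ N :: r) IHx // sub0seq.
move: Nx; rewrite /= inE negb_or => /andP [_ Nx].
case: eqP => _; last exact: (IHx (a :: s)).
by move: Ns; rewrite inE negb_or => /andP [_ Ns]; apply: IHx.
Qed.

Lemma subseq_pivot_uniq s r x y :
    N \notin x -> N \notin y -> N \notin s ->
  subseq (s ++ N :: r) (x ++ N :: y) = subseq s x && subseq r y.
Proof.
move=> Nx Ny Ns; rewrite subseq_pivot // orbC.
case: (boolP (subseq _ (x ++ y))) => // /mem_subseq /(_ N).
by rewrite !mem_cat mem_head orbT (negPf Nx) (negPf Ny) => /(_ isT).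
Qed.

Lemma subseq_pivot_twice s r x y z :
    N \notin x ++ y ++ z -> N \notin s -> N \notin r ->
  subseq (s ++ N :: r) (x ++ N :: y ++ N :: z) =
  subseq s x && subseq r (y ++ z) || subseq s (x ++ y) && subseq r z.
Proof.
rewrite !mem_cat !negb_or => /and3P [Nx Ny Nz] Ns Nr.
rewrite subseq_pivot // catA subseq_pivot_uniq // ?mem_cat ?negb_or ?Nx //.
by rewrite -(subseq_filter_predC1 (y ++ N :: z)) // filter_cat /= eqxx
  !filter_predC1_id.
Qed.

Lemma subseq_cons_pivot r x y : N \notin x ->
  subseq (N :: r) (x ++ N :: y) = subseq r y.
Proof.
elim: x => [|b x IHx] /=; first by rewrite eqxx.
by rewrite inE negb_or => /andP [/negPf -> /IHx].
Qed.

Lemma subseq_cons2_pivot a r x y : N \notin x -> a \in x ->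
  subseq (a :: N :: r) (x ++ N :: y) = subseq r y.
Proof.
elim: x => [|b x IHx] //.
rewrite !inE negb_or => /andP [Nb Nx] /=; case: eqP => [_ _|_ /= xa].
  exact: subseq_cons_pivot.
exact: IHx.
Qed.

Lemma subseq_notin s x : N \in s -> N \notin x -> subseq s x = false.
Proof. by move=> sN xN; apply: contraNF xN => /mem_subseq; apply. Qed.

End MarkedLetter.

(** * Patterns whose largest letter occurs once *)

Lemma order_isoP s t :
  reflect (exists2 h, {in t &, {mono h : i j / i < j}} & s = map h t)
          (order_iso s t).
Proof.
apply: (iffP andP) => [[/eqP sz_st /forallP iso]|[h h_mono ->]]; last first.
  rewrite size_map eqxx; split=> //; apply/forallP => i; apply/forallP => j.
  by rewrite !(nth_map 0) // h_mono ?mem_nth.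
have lt_iso i j : i < size t -> j < size t ->
    (nth 0 s i < nth 0 s j) = (nth 0 t i < nth 0 t j).
  rewrite -sz_st => it jt.
  by have /forallP/(_ (Ordinal jt))/eqP := iso (Ordinal it).
exists (fun a => nth 0 s (index a t)) => [a b ta tb|].
  by rewrite lt_iso ?index_mem ?nth_index.
apply: (@eq_from_nth _ 0); rewrite ?size_map // sz_st => i it.
rewrite (nth_map 0) //; set k := index _ t.
have kt : k < size t by rewrite index_mem mem_nth.
have tk : nth 0 t k = nth 0 t i by rewrite nth_index ?mem_nth.
by case: (ltngtP (nth 0 s i) (nth 0 s k)); rewrite // lt_iso // tk ltnn.
Qed.

Lemma word_containsP w tau :
  reflect (exists2 h, {in tau &, {mono h : i j / i < j}} & subseq (map h tau) w)
          (word_contains w tau).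
Proof.
apply: (iffP existsP) => [[s /order_isoP [h h_mono e]]|[h h_mono]].
  by exists h => //; rewrite -e mask_subseq.
case/subseqP => m szm e; exists (tcast szm (in_tuple m)).
by rewrite val_tcast -e; apply/order_isoP; exists h.
Qed.

Definition occurs_across (u v x y : seq nat) : bool :=
  [exists r : (size x).-tuple bool, exists s : (size y).-tuple bool,
     (size (mask r x) == size u) && order_iso (mask r x ++ mask s y) (u ++ v)].

Lemma occurs_acrossP u v x y :
  reflect (exists h, [/\ {in u ++ v &, {mono h : i j / i < j}},
             subseq (map h u) x & subseq (map h v) y])
          (occurs_across u v x y).
Proof.
apply: (iffP existsP) => [[r /existsP [s /andP [/eqP szu /order_isoP [h]]]]|].
  move=> h_mono /eqP; rewrite map_cat eqseq_cat ?size_map // => /andP [ux vy].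
  by exists h; rewrite -(eqP ux) -(eqP vy) !mask_subseq.
case=> h [h_mono /subseqP [r szr ux] /subseqP [s szs vy]].
exists (tcast szr (in_tuple r)); apply/existsP; exists (tcast szs (in_tuple s)).
rewrite !val_tcast -ux -vy size_map eqxx /=.
by apply/order_isoP; exists h; rewrite ?map_cat.
Qed.

Section TopLetter.

Variables (u v : seq nat) (c : nat).
Hypothesis lt_c : {in u ++ v, forall i, i < c}.

Lemma mono_extend_top h N :
    {in u ++ v &, {mono h : i j / i < j}} -> {in u ++ v, forall i, h i < N} ->
  exists2 h', {in u ++ c :: v &, {mono h' : i j / i < j}} &
              map h' (u ++ c :: v) = map h u ++ N :: map h v.
Proof.
move=> h_mono ltN; exists (fun i => if i == c then N else h i); last first.
  rewrite map_cat /= eqxx; congr (_ ++ _ :: _); apply/eq_in_map => i iuv.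
    by rewrite ltn_eqF // lt_c // mem_cat iuv.
  by rewrite ltn_eqF // lt_c // mem_cat iuv orbT.
have memE i : (i \in u ++ c :: v) = (i == c) || (i \in u ++ v).
  by rewrite !mem_cat inE orbCA.
move=> i j; rewrite !memE.
have [-> _|_ /= iuv] := eqVneq i c; have [-> _|_ /= juv] := eqVneq j c.
- by rewrite !ltnn.
- by have := ltN j juv; have := lt_c juv; lia.
- by rewrite ltN // lt_c.
exact: h_mono.
Qed.

Lemma word_contains_top N w : {in w, forall a, a <= N} ->
  word_contains w (u ++ c :: v) <->
  word_contains (filter (predC1 N) w) (u ++ c :: v) \/
  exists h, [/\ {in u ++ v &, {mono h : i j / i < j}},
    {in u ++ v, forall i, h i < N} & subseq (map h u ++ N :: map h v) w].
Proof.
have c_in : c \in u ++ c :: v by rewrite mem_cat mem_head orbT.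
have sub_uv : {subset u ++ v <= u ++ c :: v}.
  by move=> i; rewrite !mem_cat inE => /orP [->|->] //; rewrite !orbT.
move=> leN; split=> [/word_containsP [h h_mono sub]|[|[h [h_mono ltN sub]]]].
- have [/mapP [i i_in hi]|N_notin] := boolP (N \in map h (u ++ c :: v));
  last first.
    by left; apply/word_containsP; exists h; rewrite ?subseq_filter_predC1.
  have hc : h c = N.
    have le_hc : h c <= N by apply/leN/(mem_subseq sub)/map_f.
    have le_ic : i <= c.
      move: i_in; rewrite mem_cat inE orbCA -mem_cat.
      by case/predU1P => [->|/lt_c /ltnW].
    by apply/eqP; rewrite eqn_leq le_hc hi leqNgt h_mono // -leqNgt.
  right; exists h; split; first exact: sub_in2 h_mono.
    by move=> j juv; rewrite -hc h_mono ?lt_c //; apply: sub_uv.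
  by rewrite -hc -map_cons -map_cat.
- case/word_containsP => h h_mono sub; apply/word_containsP; exists h => //.
  exact: subseq_trans sub (filter_subseq _ _).
have [h' h'_mono map_h'] := mono_extend_top h_mono ltN.
by apply/word_containsP; exists h'; rewrite ?map_h'.
Qed.

Lemma occurs_across_ltP N x y : {in x ++ y, forall a, a < N} ->
  reflect (exists h, [/\ {in u ++ v &, {mono h : i j / i < j}},
             {in u ++ v, forall i, h i < N}, subseq (map h u) x &
             subseq (map h v) y])
          (occurs_across u v x y).
Proof.
move=> ltN; apply: (iffP (occurs_acrossP u v x y)) => -[h]; last first.
  by case=> h_mono _ ux vy; exists h.
case=> h_mono ux vy; exists h; split=> // i iuv; apply/ltN.
by apply: (mem_subseq (cat_subseq ux vy)); rewrite -map_cat map_f.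
Qed.

(* The new letter [N], being the largest, can only play the role of [c]. *)
Lemma word_contains_insert N x y z : {in x ++ y ++ z, forall a, a < N} ->
  word_contains (x ++ N :: y ++ N :: z) (u ++ c :: v) =
  [|| word_contains (x ++ y ++ z) (u ++ c :: v),
      occurs_across u v x (y ++ z) | occurs_across u v (x ++ y) z].
Proof.
move=> ltN; have Nxyz : N \notin x ++ y ++ z.
  by apply/negP => /ltN; rewrite ltnn.
have ltN' : {in (x ++ y) ++ z, forall a, a < N} by rewrite -catA.
have filterN : filter (predC1 N) (x ++ N :: y ++ N :: z) = x ++ y ++ z.
  by rewrite -[RHS](filter_predC1_id Nxyz) !filter_cat /= filter_cat /= eqxx.
have leN : {in x ++ N :: y ++ N :: z, forall a, a <= N}.
  move=> a aw; have [-> //|aN] := eqVneq a N; apply/ltnW/ltN.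
  by rewrite -filterN mem_filter /= aN.
have pivot h : {in u ++ v, forall i, h i < N} ->
    subseq (map h u ++ N :: map h v) (x ++ N :: y ++ N :: z) =
    subseq (map h u) x && subseq (map h v) (y ++ z) ||
    subseq (map h u) (x ++ y) && subseq (map h v) z.
  move=> hN; have : N \notin map h (u ++ v).
    by apply/negP => /mapP [i /hN hi e]; rewrite -e ltnn in hi.
  by rewrite map_cat mem_cat negb_or => /andP [Nu Nv];
    apply: subseq_pivot_twice.
apply/idP/or3P => [/(word_contains_top leN)|].
  rewrite filterN => -[cont|[h [h_mono hN]]]; first exact: Or31.
  rewrite pivot // => /orP [] /andP [ux vy].
    by apply/Or32/(occurs_across_ltP ltN); exists h.
  by apply/Or33/(occurs_across_ltP ltN'); exists h.
move=> cases; apply/(word_contains_top leN); rewrite filterN.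
case: cases => [|/(occurs_across_ltP ltN)|/(occurs_across_ltP ltN')];
  first by left.
- by case=> h [h_mono hN ux vy]; right; exists h; rewrite pivot // ux vy.
by case=> h [h_mono hN ux vy]; right; exists h; rewrite pivot // ux vy orbT.
Qed.

End TopLetter.

(** * The six patterns *)

Variant pattern := P12312 | P12132 | P12123 | P12321 | P12231 | P12213.

Definition before3 (t : pattern) : seq nat :=
  match t with
  | P12312 | P12321 => [:: 1; 2]
  | P12132 => [:: 1; 2; 1]
  | P12123 => [:: 1; 2; 1; 2]
  | P12231 => [:: 1; 2; 2]
  | P12213 => [:: 1; 2; 2; 1]
  end.

Definition after3 (t : pattern) : seq nat :=
  match t with
  | P12312 => [:: 1; 2]
  | P12132 => [:: 2]
  | P12321 => [:: 2; 1]
  | P12231 => [:: 1]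
  | P12123 | P12213 => [::]
  end.

Definition pattern_word (t : pattern) : seq nat := before3 t ++ 3 :: after3 t.

Definition obstructed (t : pattern) (x y : seq nat) : bool :=
  occurs_across (before3 t) (after3 t) x y.

Lemma contains_insert t N x y z : {in x ++ y ++ z, forall a, a < N} ->
  word_contains (x ++ N :: y ++ N :: z) (pattern_word t) =
  [|| word_contains (x ++ y ++ z) (pattern_word t),
      obstructed t x (y ++ z) | obstructed t (x ++ y) z].
Proof. by apply: word_contains_insert; case: t; apply/allP. Qed.

Definition subst12 (a b : nat) (s : seq nat) : seq nat :=
  [seq if i == 1 then a else b | i <- s].

Lemma obstructedP t x y :
  reflect (exists a b, [/\ a < b, subseq (subst12 a b (before3 t)) x &
             subseq (subst12 a b (after3 t)) y])
          (obstructed t x y).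
Proof.
apply: (iffP (occurs_acrossP _ _ _ _)) => [[h [h_mono ux vy]]|].
  by exists (h 1), (h 2); rewrite h_mono; case: t {h_mono} ux vy.
case=> a [b [ab ux vy]]; exists (fun i => if i == 1 then a else b).
split=> // i j i_uv j_uv.
have letters : {subset before3 t ++ after3 t <= [:: 1; 2]}.
  by case: t {ux vy i_uv j_uv}; apply/allP.
move: (letters i i_uv) (letters j j_uv); rewrite !inE.
by case/orP => /eqP -> /orP [] /eqP -> /=; lia.
Qed.

Lemma subst12_before3_mem t a b x :
  subseq (subst12 a b (before3 t)) x -> a \in x /\ b \in x.
Proof.
by move/mem_subseq => sub; split; apply: sub; case: t;
  rewrite /= !inE eqxx ?orbT.
Qed.

(* Being larger than every other letter of [X], the letter [N] can only play the
   role of 2. *)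
Lemma unobstructed_insert t N x X Y : {in x, forall a, a < N} -> X =i N :: x ->
  ~~ obstructed t X Y =
  ~~ obstructed t (filter (predC1 N) X) (filter (predC1 N) Y) &&
  all (fun a => ~~ (subseq (subst12 a N (before3 t)) X &&
                    subseq (subst12 a N (after3 t)) Y)) x.
Proof.
move=> ltN memX; rewrite all_predC -negb_or; congr (~~ _).
apply/obstructedP/orP => [[a [b [ab uX vY]]]|[/obstructedP|/hasP]];
  last 2 first.
- case=> a [b [ab uX vY]]; exists a, b.
  by split=> //; [move: uX|move: vY] => /subseq_trans; apply;
    apply: filter_subseq.
- by case=> a /ltN aN /andP [uX vY]; exists a, N.
have [aX bX] := subst12_before3_mem uX; rewrite !memX !inE in aX bX.
case/predU1P: bX => [bN|/ltN bN]; last first.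
  have fresh s : N \notin subst12 a b s by apply/mapP => -[i _]; case: ifP; lia.
  by left; apply/obstructedP; exists a, b; rewrite !subseq_filter_predC1.
right; apply/hasP; exists a; last by rewrite -bN uX vY.
by case/predU1P: aX => // aN; rewrite aN bN ltnn in ab.
Qed.

(* The left part must contain every letter of the right part because the new
   letter may only be inserted after all first occurrences. *)
Definition open_gap t (x y : seq nat) : bool :=
  all [in x] y && ~~ obstructed t x y.

(* Whether inserting a new largest letter [N] into [x ++ y ++ z] on both sides
   of [y] keeps open a gap that splits [y] into [y1] and [y2]. Applied to
   [a \notin y1], [a \notin y2], [a \notin z] it says that [a] and [N] do not
   form an obstruction, and applied to the emptiness of the three words, that no
   letter does. *)
Definition stays_open_inside t (no_y1 no_y2 no_z : bool) : bool :=
  match t with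
  | P12312 => no_y2
  | P12132 => no_y1
  | P12321 => no_z
  | _ => true
  end.

(* The same for a gap that splits [z] into [z1] and [z2]. *)
Definition stays_open_after t (no_y no_z1 no_z2 : bool) : bool :=
  match t with
  | P12123 => no_y
  | P12231 => no_z2
  | P12213 => no_z1
  | _ => true
  end.

Lemma all_notin (T : eqType) (x y : seq T) :
  {subset y <= x} -> all [predC y] x = nilp y.
Proof.
move=> yx; apply/allP/nilP => [y_none|-> //].
case: y yx y_none => // a y yx /(_ a (yx a (mem_head a y))).
by rewrite /= mem_head.
Qed.

Section InsertLargest.

Variables (t : pattern) (N : nat) (x : seq nat).
Hypothesis ltN : {in x, forall a, a < N}.

Let N_notin (y : seq nat) : {subset y <= x} -> N \notin y.
Proof. by move=> yx; apply/negP => /yx /ltN; rewrite ltnn. Qed.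

Lemma new_obstruction_inside y1 y2 z a :
    {subset y1 <= x} -> {subset y2 <= x} -> {subset z <= x} -> a \in x ->
  subseq (subst12 a N (before3 t)) (x ++ N :: y1) &&
  subseq (subst12 a N (after3 t)) (y2 ++ N :: z) =
  ~~ stays_open_inside t (a \notin y1) (a \notin y2) (a \notin z).
Proof.
move=> /N_notin Ny1 /N_notin Ny2 /N_notin Nz ax.
have Nx := N_notin (fun b => id).
have Na : N \notin [:: a] by rewrite inE gtn_eqF // ltN.
case: t => /=;
  rewrite ?(subseq_cons2_pivot _ _ Nx ax) ?sub0seq ?sub1seq ?negbK /=.
- by rewrite (@subseq_pivot_uniq _ _ [:: a]) // sub1seq sub0seq andbT.
- by rewrite mem_cat mem_head orbT andbT.
- by rewrite andbT (@subseq_notin _ N) // !inE eqxx orbT.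
- by rewrite subseq_cons_pivot // sub1seq.
- by rewrite (negPf Ny1).
by rewrite andbT (@subseq_notin _ N) // !inE eqxx.
Qed.

Lemma new_obstruction_after y z1 z2 a :
    {subset y <= x} -> {subset z1 <= x} -> {subset z2 <= x} -> a \in x ->
  subseq (subst12 a N (before3 t)) (x ++ N :: y ++ N :: z1) &&
  subseq (subst12 a N (after3 t)) z2 =
  ~~ stays_open_after t (a \notin y) (a \notin z1) (a \notin z2).
Proof.
move=> /N_notin Ny /N_notin Nz1 /N_notin Nz2 ax.
have Nx := N_notin (fun b => id).
have Na : N \notin [:: a] by rewrite inE gtn_eqF // ltN.
case: t => /=;
  rewrite ?(subseq_cons2_pivot _ _ Nx ax) ?sub0seq ?sub1seq ?negbK ?andbT /=.
- by rewrite (@subseq_notin _ N) // !inE eqxx orbT.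
- by rewrite (negPf Nz2) andbF.
- by rewrite (@subseq_pivot_uniq _ _ [:: a]) // sub1seq sub0seq andbT.
- by rewrite (@subseq_notin _ N) // !inE eqxx.
- by rewrite mem_cat mem_head orbT.
by rewrite subseq_cons_pivot // sub1seq.
Qed.

Lemma open_gap_inside y1 y2 z : {subset y1 ++ y2 ++ z <= x} ->
  open_gap t (x ++ N :: y1) (y2 ++ N :: z) =
  open_gap t (x ++ y1) (y2 ++ z) &&
  stays_open_inside t (nilp y1) (nilp y2) (nilp z).
Proof.
move=> yzx.
have y1x : {subset y1 <= x} by move=> a ay; rewrite yzx // mem_cat ay.
have y2x : {subset y2 <= x} by move=> a ay; rewrite yzx // !mem_cat ay orbT.
have zx : {subset z <= x} by move=> a az; rewrite yzx // !mem_cat az !orbT.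
have Nx := N_notin (fun a => id).
rewrite /open_gap; have -> : all [in x ++ N :: y1] (y2 ++ N :: z).
  apply/allP => a; rewrite !mem_cat !inE => /or3P [/y2x ->|->|/zx ->] //.
  by rewrite orbT.
have -> : all [in x ++ y1] (y2 ++ z).
  by apply/allP => a; rewrite !mem_cat => /orP [/y2x ->|/zx ->].
rewrite /= (unobstructed_insert t _ ltN) => [|a]; last first.
  rewrite mem_cat !inE orbCA; case: (boolP (a \in y1)) => [/y1x ->|_] //.
  by rewrite orbF.
rewrite !filter_cat /= eqxx !filter_predC1_id ?N_notin //; congr (_ && _).
transitivity (all (fun a =>
    stays_open_inside t (a \notin y1) (a \notin y2) (a \notin z)) x).
  by apply: eq_in_all => a ax; rewrite new_obstruction_inside // negbK.
by case: t; rewrite /= ?all_predT ?all_notin.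
Qed.

Lemma open_gap_after y z1 z2 : {subset y ++ z1 ++ z2 <= x} ->
  open_gap t (x ++ N :: y ++ N :: z1) z2 =
  open_gap t (x ++ y ++ z1) z2 &&
  stays_open_after t (nilp y) (nilp z1) (nilp z2).
Proof.
move=> yzx; have yx : {subset y <= x} by move=> a ay; rewrite yzx // mem_cat ay.
have z1x : {subset z1 <= x} by move=> a az; rewrite yzx // !mem_cat az orbT.
have z2x : {subset z2 <= x} by move=> a az; rewrite yzx // !mem_cat az !orbT.
have Nx := N_notin (fun a => id).
rewrite /open_gap; have -> : all [in x ++ N :: y ++ N :: z1] z2.
  by apply/allP => a /z2x ax; rewrite mem_cat ax.
have -> : all [in x ++ y ++ z1] z2.
  by apply/allP => a /z2x ax; rewrite mem_cat ax.
rewrite /= (unobstructed_insert t _ ltN) => [|a]; last first.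
  rewrite mem_cat inE mem_cat !inE.
  case: (boolP (a \in y)) => [/yx ->|_]; first by rewrite !orbT.
  case: (boolP (a \in z1)) => [/z1x ->|_]; first by rewrite !orbT.
  by rewrite orbF /= orbb orbC.
rewrite filter_cat /= filter_cat /= eqxx !filter_predC1_id ?N_notin //.
congr (_ && _); transitivity (all (fun a =>
    stays_open_after t (a \notin y) (a \notin z1) (a \notin z2)) x).
  by apply: eq_in_all => a ax; rewrite new_obstruction_after // negbK.
by case: t; rewrite /= ?all_predT ?all_notin.
Qed.

End InsertLargest.

(** * Open gaps after an insertion *)

Section Slice.

Variable T : Type.
Implicit Type w : seq T.

Definition slice p q w : seq T := drop p (take q w).

Lemma cat_take_slice p q w : p <= q -> take p w ++ slice p q w = take q w.
Proof. by move=> pq; rewrite -(take_takel w pq) cat_take_drop. Qed.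

Lemma cat_slice_drop p q w : p <= q -> slice p q w ++ drop q w = drop p w.
Proof.
move=> pq; have : take p w ++ slice p q w ++ drop q w = take p w ++ drop p w.
  by rewrite catA cat_take_slice // !cat_take_drop.
by move/(congr1 (drop (size (take p w)))); rewrite !drop_size_cat.
Qed.

Lemma cat_slice p x q w :
  p <= x <= q -> slice p x w ++ slice x q w = slice p q w.
Proof.
move=> /andP [px xq]; rewrite -[RHS](cat_slice_drop _ px).
by rewrite /slice take_takel.
Qed.

Lemma size_slice p q w : q <= size w -> size (slice p q w) = q - p.
Proof. by move=> qw; rewrite size_drop size_takel. Qed.

Lemma nilp_slice p q w : p <= q <= size w -> nilp (slice p q w) = (p == q).
Proof.
by move=> /andP [pq qw]; rewrite /nilp size_slice // subn_eq0 eqn_leq pq.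
Qed.

Lemma nilp_drop p w : p <= size w -> nilp (drop p w) = (p == size w).
Proof. by move=> pw; rewrite /nilp size_drop subn_eq0 eqn_leq pw. Qed.

Definition insert_pair (N : T) p q w : seq T :=
  take p w ++ N :: slice p q w ++ N :: drop q w.

Lemma insert_pair_cat (N : T) x y z :
  insert_pair N (size x) (size x + size y) (x ++ y ++ z) =
  x ++ N :: y ++ N :: z.
Proof.
rewrite /insert_pair /slice take_size_cat // catA -size_cat.
by rewrite take_size_cat // !drop_size_cat.
Qed.

Lemma size_insert_pair N p q w :
  p <= q -> size (insert_pair N p q w) = (size w).+2.
Proof.
move=> pq; rewrite -[in RHS](cat_take_drop p w) -(cat_slice_drop w pq).
by rewrite /insert_pair !size_cat /= size_cat /= !addnS.
Qed.

End Slice.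

Lemma insert_pair_inj (T : eqType) (N : T) p q w p' q' w' :
    p <= q <= size w -> p' <= q' <= size w' ->
    N \notin w -> N \notin w' ->
    insert_pair N p q w = insert_pair N p' q' w' ->
  [/\ w = w', p = p' & q = q'].
Proof.
move=> /andP [pq qw] /andP [pq' qw'] Nw Nw' /eqP.
have N_take v r : N \notin v -> N \notin take r v.
  by apply: contraNN; apply: mem_take.
have N_slice v r s : N \notin v -> N \notin slice r s v.
  by apply: contraNN => /mem_drop /mem_take.
rewrite eqseq_pivot2l ?N_take // eqseq_pivot2l ?N_slice //.
case/and3P => /eqP et /eqP es /eqP ed.
have ww' : w = w'.
  rewrite -(cat_take_drop p w) -(cat_slice_drop w pq) et es ed.
  by rewrite cat_slice_drop // cat_take_drop.
subst w'; have pp' : p = p'.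
  by have := congr1 size et; rewrite !size_takel //; lia.
by have := congr1 size es; rewrite !size_slice //; split=> //; lia.
Qed.

Definition gap t w p : bool := open_gap t (take p w) (drop p w).

Definition gaps t w : seq nat := [seq p <- iota 0 (size w).+1 | gap t w p].

Lemma mem_gaps t w p : (p \in gaps t w) = gap t w p && (p <= size w).
Proof. by rewrite mem_filter mem_iota. Qed.

Lemma gaps_sorted t w : sorted ltn (gaps t w).
Proof. exact/(sorted_filter ltn_trans)/iota_ltn_sorted. Qed.

Lemma gaps_uniq t w : uniq (gaps t w).
Proof. exact/filter_uniq/iota_uniq. Qed.

Lemma gap_cat t x y : gap t (x ++ y) (size x) = open_gap t x y.
Proof. by rewrite /gap take_size_cat ?drop_size_cat. Qed.

Lemma gap_subset t w p : gap t w p -> {subset w <= take p w}.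
Proof.
move=> /andP [/allP right_left _] a.
by rewrite -{1}(cat_take_drop p w) mem_cat => /orP [//|/right_left].
Qed.

Lemma gap_size t w : after3 t != [::] -> gap t w (size w).
Proof.
move=> after_nonnil; rewrite /gap take_size drop_size /open_gap /=.
by apply/obstructedP => -[a [b [_ _]]]; case: (after3 t) after_nonnil.
Qed.

Lemma gap_insert_before t N (w : seq nat) p q x :
  N \notin w -> x <= p <= size w -> gap t (insert_pair N p q w) x = false.
Proof.
move=> Nw /andP [xp pw]; apply/negP => /gap_subset /(_ N).
rewrite {1}/insert_pair mem_cat mem_head orbT /insert_pair.
rewrite takel_cat ?size_takel // take_takel // => /(_ isT) /mem_take.
by rewrite (negPf Nw).
Qed.

Section InsertGaps.

Variables (t : pattern) (N : nat) (w : seq nat) (p q : nat).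
Hypotheses (ltN : {in w, forall a, a < N}) (gap_p : gap t w p).
Hypothesis pqw : p <= q <= size w.

Let ltN_take : {in take p w, forall a, a < N}.
Proof. by move=> a /mem_take /ltN. Qed.

Let drop_sub_take : {subset drop p w <= take p w}.
Proof. by move=> a /mem_drop /(gap_subset gap_p). Qed.

Lemma gap_insert_inside x : p <= x <= q ->
  gap t (insert_pair N p q w) x.+1 =
  gap t w x && stays_open_inside t (p == x) (x == q) (q == size w).
Proof.
move=> pxq; have [/andP [px xq] /andP [pq qw]] := (pxq, pqw).
have xw := leq_trans xq qw.
have -> : insert_pair N p q w =
    (take p w ++ N :: slice p x w) ++ slice x q w ++ N :: drop q w.
  by rewrite /insert_pair -(cat_slice w pxq) -!catA.
have szx : size (take p w ++ N :: slice p x w) = x.+1.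
  by rewrite size_cat /= size_slice ?size_takel //; lia.
rewrite -szx gap_cat open_gap_inside //; last first.
  by rewrite catA cat_slice // cat_slice_drop.
by rewrite cat_take_slice // cat_slice_drop // !nilp_slice ?nilp_drop ?px ?xq.
Qed.

Lemma gap_insert_after x : q <= x <= size w ->
  gap t (insert_pair N p q w) x.+2 =
  gap t w x && stays_open_after t (p == q) (q == x) (x == size w).
Proof.
move=> qxw; have [/andP [qx xw] /andP [pq qw]] := (qxw, pqw).
have -> : insert_pair N p q w =
    (take p w ++ N :: slice p q w ++ N :: slice q x w) ++ drop x w.
  by rewrite /insert_pair -(cat_slice_drop w qx) -!(catA, cat_cons).
have szx : size (take p w ++ N :: slice p q w ++ N :: slice q x w) = x.+2.
  by rewrite size_cat /= size_cat /= !size_slice ?size_takel //; lia.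
rewrite -szx gap_cat open_gap_after //; last first.
  by rewrite !cat_slice_drop.
by rewrite catA !cat_take_slice // !nilp_slice ?nilp_drop ?pq.
Qed.

Lemma size_gaps_insert :
  size (gaps t (insert_pair N p q w)) =
  count (fun x => (p <= x <= q) &&
           stays_open_inside t (p == x) (x == q) (q == size w)) (gaps t w) +
  count (fun x => (q <= x) &&
           stays_open_after t (p == q) (q == x) (x == size w)) (gaps t w).
Proof.
have /andP [pq qw] := pqw; rewrite -!size_filter.
set s1 := filter _ _; set s2 := filter _ _.
have mem_shift k (s : seq nat) x :
    (x \in [seq k + y | y <- s]) = (k <= x) && (x - k \in s).
  apply/mapP/andP => [[y ys ->]|[kx xs]]; first by rewrite leq_addr addKn.
  by exists (x - k); rewrite ?subnKC.
have mem_s (P : pred nat) x :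
    (x \in filter P (gaps t w)) = [&& P x, gap t w x & x <= size w].
  by rewrite mem_filter mem_gaps.
rewrite -(size_map (addn 1) s1) -(size_map (addn 2) s2) -size_cat.
have Nw : N \notin w by apply/negP => /ltN; rewrite ltnn.
apply/perm_size/uniq_perm; first exact: gaps_uniq.
  have [uniq1 uniq2] : uniq s1 /\ uniq s2 by split; apply/filter_uniq/gaps_uniq.
  rewrite cat_uniq !(map_inj_uniq (@addnI _)) uniq1 uniq2 andbT /=.
  apply/hasPn => x; rewrite /= !mem_shift !mem_s; lia.
move=> x; rewrite mem_cat !mem_shift !mem_s mem_gaps size_insert_pair //.
case: (leqP x p) => [xp|]; first by rewrite gap_insert_before //; lia.
case: x => // x px; case: (leqP x q) => [xq|].
  by rewrite gap_insert_inside ?subn1 /=; lia.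
case: x px => // x px qx; case: (leqP x (size w)) => xw; last by lia.
by rewrite gap_insert_after ?subn2 /=; lia.
Qed.

End InsertGaps.

Lemma sorted_ltn_nth_leq s : sorted ltn s ->
  {in gtn (size s) &, {mono nth 0 s : i j / i <= j}}.
Proof. exact: (@lt_sorted_leq_nth _ nat). Qed.

Lemma nth_gap t w i : i < size (gaps t w) ->
  gap t w (nth 0 (gaps t w) i) /\ nth 0 (gaps t w) i <= size w.
Proof. by move=> iK; have := mem_nth 0 iK; rewrite mem_gaps => /andP. Qed.

Lemma nth_gaps_eq_size t w i : after3 t != [::] -> i < size (gaps t w) ->
  (nth 0 (gaps t w) i == size w) = (i.+1 == size (gaps t w)).
Proof.
move=> after_nonnil iK; have w_gap : size w \in gaps t w.
  by rewrite mem_gaps gap_size // leqnn.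
have rank_lt : index (size w) (gaps t w) < size (gaps t w) by rewrite index_mem.
rewrite -{1}(nth_index 0 w_gap) nth_uniq ?gaps_uniq //.
suff : (size (gaps t w)).-1 <= index (size w) (gaps t w) by lia.
rewrite -(sorted_ltn_nth_leq (gaps_sorted t w)) // ?inE; last by lia.
by rewrite nth_index //; apply: (proj2 (nth_gap _)); lia.
Qed.

Lemma count_nth (P : pred nat) s :
  count P s = count (fun i => P (nth 0 s i)) (iota 0 (size s)).
Proof. by rewrite -{1}(mkseq_nth 0 s) count_map. Qed.

Lemma count_iota_interval (P : pred nat) a b K : a <= b <= K ->
    (forall x, x < K -> P x = (a <= x < b)) ->
  count P (iota 0 K) = b - a.
Proof.
move=> abK PE; rewrite -size_filter -[RHS](size_iota a).
apply/perm_size/uniq_perm; rewrite ?filter_uniq ?iota_uniq // => x.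
rewrite mem_filter !mem_iota; case: (ltnP x K) => xK; last by lia.
by rewrite PE //; lia.
Qed.

(* Number of open gaps after insertion at those of ranks i <= j among K. *)
Definition child_size t K i j : nat :=
  match t with
  | P12312 | P12132 => (K - j).+1
  | P12123 => if i == j then (K - j).+1 else (j - i).+1
  | P12321 => if j.+1 == K then (K - i).+1 else K - j
  | P12231 | P12213 => (j - i).+2
  end.

Lemma child_sizeE t K i j : i <= j < K ->
  count (fun k => (i <= k <= j) &&
           stays_open_inside t (i == k) (k == j) (j.+1 == K)) (iota 0 K) +
  count (fun k => (j <= k) &&
           stays_open_after t (i == j) (j == k) (k.+1 == K)) (iota 0 K) =
  child_size t K i j.
Proof.
move=> ijK; pose cnt a b P := @count_iota_interval P a b K.
case: t => /=.
- rewrite (cnt j j.+1) ?(cnt j K); lia.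
- rewrite (cnt i i.+1) ?(cnt j K); lia.
- rewrite (cnt i j.+1) 1?[X in _ + X](cnt j (if i == j then K else j));
    case: (i =P j); lia.
- rewrite (cnt i (if j.+1 == K then j.+1 else i)) ?(cnt j K);
    case: (j.+1 =P K); lia.
- rewrite (cnt i j.+1) ?(cnt K.-1 K); lia.
- rewrite (cnt i j.+1) ?(cnt j j.+1); lia.
Qed.

Lemma size_gaps_child t N (w : seq nat) i j (s := gaps t w) :
    {in w, forall a, a < N} -> i <= j < size s ->
  size (gaps t (insert_pair N (nth 0 s i) (nth 0 s j) w)) =
  child_size t (size s) i j.
Proof.
move=> ltN ijs; have /andP [ij js] := ijs; have iS := leq_ltn_trans ij js.
have le_nth : {in gtn (size s) &, {mono nth 0 s : k l / k <= l}}.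
  exact/sorted_ltn_nth_leq/gaps_sorted.
have eq_nth k l : k < size s -> l < size s ->
    (nth 0 s k == nth 0 s l) = (k == l).
  by move=> ks ls; rewrite nth_uniq ?gaps_uniq.
have [[gap_i _] [_ jw]] := (nth_gap iS, nth_gap js).
rewrite -(child_sizeE t ijs) size_gaps_insert ?le_nth ?ij // -/s.
rewrite 2!(count_nth _ s).
congr (_ + _); apply: eq_in_count => k; rewrite mem_iota => ks.
  rewrite !le_nth // !eq_nth //; congr (_ && _).
  by case E: t => //=; rewrite /s nth_gaps_eq_size // E.
rewrite !le_nth // !eq_nth //; congr (_ && _).
by case E: t => //=; rewrite /s nth_gaps_eq_size // E.
Qed.

(** * The generating tree *)

Definition le_pairs (s : seq nat) : seq (nat * nat) :=
  [seq (p, q) | q <- s, p <- [seq p <- s | p <= q]].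

Lemma mem_le_pairs s p q :
  ((p, q) \in le_pairs s) = [&& p \in s, q \in s & p <= q].
Proof.
apply/allpairsPdep/and3P => [[q' [p' [qs]]]|[ps qs pq]].
  by rewrite mem_filter => /andP [pq ps] [-> ->].
by exists q, p; rewrite mem_filter pq.
Qed.

Lemma le_pairs_uniq s : uniq s -> uniq (le_pairs s).
Proof.
move=> s_uniq; apply: allpairs_uniq_dep => // [q _|]; first exact: filter_uniq.
by move=> [q p] [q' p'] _ _ /= [-> ->].
Qed.

Lemma sum_le_pairs s (F : nat -> nat -> nat) : sorted ltn s ->
  \sum_(pq <- le_pairs s) F pq.1 pq.2 =
  \sum_(j < size s) \sum_(i < j.+1) F (nth 0 s i) (nth 0 s j).
Proof.
move=> s_lt; rewrite big_allpairs_dep /= (big_nth 0) big_mkord.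
apply: eq_bigr => j _; rewrite big_filter (big_nth 0) big_mkord.
rewrite (big_ord_widen (size s) (fun i => F (nth 0 s i) (nth 0 s j))) //.
by apply: eq_bigl => i; rewrite sorted_ltn_nth_leq // inE.
Qed.

Lemma sum_ord_sub K (g : nat -> nat) :
  \sum_(i < K) g (K - i) = \sum_(i < K) g i.+1.
Proof.
rewrite (reindex_inj rev_ord_inj) /=; apply: eq_bigr => i _.
by congr g; have := ltn_ord i; lia.
Qed.

Section TriangularSums.

Variable g : nat -> nat.

Lemma weighted_sumS K :
  \sum_(d < K.+1) (K.+1 - d) * g d =
  \sum_(d < K) (K - d) * g d + \sum_(d < K.+1) g d.
Proof.
rewrite (big_ord_recr K) [in RHS]big_ord_recr /= addnA -big_split /=;
  congr (_ + _).
  by apply: eq_bigr => d _; rewrite (subSn (ltnW (ltn_ord d))) mulSn addnC.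
by rewrite subSnn mul1n.
Qed.

Lemma triangular_sum_const K :
  \sum_(j < K) \sum_(i < j.+1) g (K - j) = \sum_(d < K) (K - d) * g d.+1.
Proof.
rewrite (reindex_inj rev_ord_inj) /=; apply: eq_bigr => j _.
rewrite sum_nat_const card_ord; have := ltn_ord j => jK.
by rewrite subnSK // subKn // ltnW.
Qed.

Lemma triangular_sum_diff K :
  \sum_(j < K) \sum_(i < j.+1) g (j - i) = \sum_(d < K) (K - d) * g d.
Proof.
elim: K => [|K IHK]; first by rewrite !big_ord0.
rewrite big_ord_recr /= IHK weighted_sumS; congr (_ + _).
rewrite (reindex_inj rev_ord_inj) /=; apply: eq_bigr => i _.
by congr g; have := ltn_ord i; lia.
Qed.

End TriangularSums.

Lemma sum_child_size t K (g : nat -> nat) :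
  \sum_(j < K) \sum_(i < j.+1) g (child_size t K i j) =
  \sum_(d < K) (K - d) * g d.+2.
Proof.
have const_sum := triangular_sum_const (fun d => g d.+1).
have diff_sum := triangular_sum_diff (fun d => g d.+2).
case: t => /=.
- exact: const_sum.
- exact: const_sum.
- case: K => [|K]; first by rewrite !big_ord0.
  rewrite (weighted_sumS (fun d => g d.+2)).
  under eq_bigr => j _ do rewrite big_ord_recr /= eqxx.
  rewrite big_split /= (sum_ord_sub K.+1 (fun d => g d.+1)); congr (_ + _).
  rewrite big_ord_recl big_ord0 add0n -diff_sum.
  apply: eq_bigr => j _; rewrite lift0; apply: eq_bigr => i _ /=.
  by have ij := ltn_ord i; rewrite ltn_eqF // subSn.
- case: K => [|K]; first by rewrite !big_ord0.
  rewrite (weighted_sumS (fun d => g d.+2)) big_ord_recr /= eqxx.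
  rewrite (sum_ord_sub K.+1 (fun d => g d.+1)); congr (_ + _).
  rewrite -const_sum; apply: eq_bigr => j _; apply: eq_bigr => i _.
  by have jK := ltn_ord j; rewrite eqSS ltn_eqF // subSn // ltnW.
- exact: diff_sum.
exact: diff_sum.
Qed.

(* [g] is a test function: among the pairs p <= q of the K open gaps of [w],
   exactly K - d lead to d + 2 open gaps. *)
Lemma sum_size_gaps_insert t N w (g : nat -> nat) : {in w, forall a, a < N} ->
  \sum_(pq <- le_pairs (gaps t w))
    g (size (gaps t (insert_pair N pq.1 pq.2 w))) =
  \sum_(d < size (gaps t w)) (size (gaps t w) - d) * g d.+2.
Proof.
move=> ltN; rewrite -(sum_child_size t).
rewrite (sum_le_pairs
  (fun p q => g (size (gaps t (insert_pair N p q w))))) ?gaps_sorted //.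
apply: eq_bigr => j _; apply: eq_bigr => i _.
by rewrite size_gaps_child // -ltnS !ltn_ord.
Qed.

(** * Canonical words avoiding a pattern *)

Definition restricted_growth (w : seq nat) : Prop :=
  forall i a, 0 < a < nth 0 w i -> a \in take i w.

Definition canonical_word n (w : seq nat) : Prop :=
  perm_eq w (iota 1 n ++ iota 1 n) /\ restricted_growth w.

Lemma mem_canonical_word n w a : canonical_word n w -> (a \in w) = (0 < a <= n).
Proof. by case=> /perm_mem -> _; rewrite mem_cat orbb mem_iota add1n. Qed.

Lemma size_canonical_word n w : canonical_word n w -> size w = 2 * n.
Proof. by case=> /perm_size -> _; rewrite size_cat size_iota addnn mul2n. Qed.

Lemma count_canonical_word n w a : canonical_word n w ->
  count_mem a w = 2 * (0 < a <= n).
Proof.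
case=> /permP -> _; rewrite count_cat !count_uniq_mem ?iota_uniq //.
by rewrite mem_iota add1n addnn mul2n.
Qed.

Lemma canonical_word_ltS n w : canonical_word n w -> {in w, forall a, a < n.+1}.
Proof. by move=> can a; rewrite (mem_canonical_word a can) => /andP []. Qed.

Lemma restricted_growth_cat x y :
    (forall a b, a \in y -> 0 < b < a -> b \in x) ->
  restricted_growth (x ++ y) <-> restricted_growth x.
Proof.
move=> y_below; split=> grow i a; have := grow i a; rewrite nth_cat take_cat;
  case: (ltnP i (size x)) => // x_le _.
- by rewrite nth_default // ltn0 andbF.
move=> a_lt; rewrite mem_cat (y_below (nth 0 y (i - size x))) //.
apply: mem_nth; rewrite ltnNge; apply/negP => y_le.
by rewrite (nth_default 0 y_le) ltn0 andbF in a_lt.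
Qed.

Lemma perm_iota_insert n x y z :
  perm_eq (x ++ n.+1 :: y ++ n.+1 :: z) (iota 1 n.+1 ++ iota 1 n.+1) =
  perm_eq (x ++ y ++ z) (iota 1 n ++ iota 1 n).
Proof.
have iotaS : iota 1 n.+1 = iota 1 n ++ [:: n.+1].
  by rewrite -(addn1 n) iotaD add1n addn1.
apply/permP/permP => eq_count_all a; have := eq_count_all a;
  rewrite iotaS !count_cat /= count_cat /=; lia.
Qed.

Lemma restricted_growth_insert n x y z :
    {subset iota 1 n <= x} -> {in y ++ z, forall a, a <= n} ->
  restricted_growth (x ++ n.+1 :: y ++ n.+1 :: z) <->
  restricted_growth (x ++ y ++ z).
Proof.
move=> x_all yz_le; apply: (iff_trans (restricted_growth_cat _)) => [a b|].
  have := yz_le a; rewrite inE !mem_cat inE => a_le a_in b_lt.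
  by apply: x_all; rewrite mem_iota; lia.
apply: iff_sym; apply: restricted_growth_cat => a b /yz_le a_le b_lt.
by apply: x_all; rewrite mem_iota; lia.
Qed.

Lemma canonical_word_insert n x y z :
  canonical_word n.+1 (x ++ n.+1 :: y ++ n.+1 :: z) <->
  canonical_word n (x ++ y ++ z) /\ {subset y ++ z <= x}.
Proof.
have letters a : perm_eq (x ++ y ++ z) (iota 1 n ++ iota 1 n) ->
    (a \in x) || (a \in y ++ z) = (a \in iota 1 n).
  by rewrite -mem_cat => /perm_mem ->; rewrite mem_cat orbb.
have yz_le : perm_eq (x ++ y ++ z) (iota 1 n ++ iota 1 n) ->
    {in y ++ z, forall a, a <= n}.
  move=> perm_w a a_yz; have := letters a perm_w.
  by rewrite a_yz orbT mem_iota => /esym/andP [].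
rewrite /canonical_word perm_iota_insert.
split=> [[perm_w grow]|[[perm_w grow] yzx]].
  have x_all : {subset iota 1 n <= x}.
    move=> b; rewrite mem_iota add1n ltnS => b_le.
    have := grow (size x) b.
    by rewrite nth_cat take_size_cat // ltnn subnn; apply.
  split.
    by split=> //; apply/(restricted_growth_insert x_all (yz_le perm_w)).
  by move=> a a_yz; apply: x_all; rewrite -letters // a_yz orbT.
split=> //; apply/restricted_growth_insert; [|exact: yz_le|by []].
by move=> a; rewrite -letters // => /orP [//|/yzx].
Qed.

Lemma two_occurrences (T : eqType) (N : T) w : 1 < count_mem N w ->
  exists x y z, w = x ++ N :: y ++ N :: z.
Proof.
elim: w => // a w IHw /=; case: eqP => [->|_ /IHw [x [y [z ->]]]].
  rewrite add1n ltnS -has_count has_pred1 => /splitPr [y z].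
  by exists [::], y, z.
by exists (a :: x), y, z.
Qed.

Definition avoider t n (w : seq nat) : Prop :=
  canonical_word n w /\ ~~ word_contains w (pattern_word t).

Lemma avoider_insert t n x y z (w := x ++ y ++ z) :
  avoider t n.+1 (x ++ n.+1 :: y ++ n.+1 :: z) <->
  [/\ avoider t n w, size x \in gaps t w & size x + size y \in gaps t w].
Proof.
have [-> ->] : size x \in gaps t w = open_gap t x (y ++ z) /\
    size x + size y \in gaps t w = open_gap t (x ++ y) z.
  rewrite !mem_gaps /w -size_cat gap_cat catA gap_cat !size_cat leq_addr andbT.
  by rewrite -addnA leq_addr andbT.
split=> [[/canonical_word_insert [can yzx]]|[[can av]]].
  rewrite contains_insert; last exact: canonical_word_ltS.
  rewrite !negb_or => /and3P [av free_p free_q]; split=> //.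
    by rewrite /open_gap free_p andbT; apply/allP.
  rewrite /open_gap free_q andbT; apply/allP => a az.
  by rewrite /= mem_cat yzx // mem_cat az orbT.
move=> /andP [/allP yzx free_p] /andP [_ free_q]; split.
  exact/canonical_word_insert.
rewrite contains_insert; last exact: canonical_word_ltS.
by rewrite !negb_or av free_p.
Qed.

Lemma gaps_nil t : gaps t [::] = [:: 0].
Proof.
rewrite /gaps /= /gap /open_gap /=; case: obstructedP => // -[a [b [_]]].
by case/subst12_before3_mem.
Qed.

Fixpoint avoiders t n : seq (seq nat) :=
  if n is m.+1 then
    [seq insert_pair m.+1 pq.1 pq.2 w
      | w <- avoiders t m, pq <- le_pairs (gaps t w)]
  else [:: [::]].

Lemma mem_avoiders t n w : w \in avoiders t n <-> avoider t n w.
Proof.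
elim: n w => [|n IHn] w.
  rewrite inE; split=> [/eqP ->|[[/perm_nilP -> //]]].
  split; first by split=> // i a; rewrite nth_nil andbF.
  by apply/word_containsP => -[h _]; case: t.
split=> [/allpairsPdep [v [[p q] [/IHn v_avoider]]]|].
  rewrite mem_le_pairs => /and3P [gap_p gap_q pq] -> /=.
  have vE : take p v ++ slice p q v ++ drop q v = v.
    by rewrite cat_slice_drop // cat_take_drop.
  apply/avoider_insert; rewrite vE size_takel ?size_slice ?subnKC //.
    by move: gap_q; rewrite mem_gaps => /andP [].
  by move: gap_p; rewrite mem_gaps => /andP [].
move=> w_avoider; have /two_occurrences [x [y [z wE]]] : 1 < count_mem n.+1 w.
  by rewrite (count_canonical_word _ w_avoider.1) leqnn.
move: w_avoider; rewrite wE => /avoider_insert [v_avoider gap_p gap_q].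
apply/allpairsPdep; exists (x ++ y ++ z), (size x, size x + size y).
rewrite mem_le_pairs gap_p gap_q leq_addr insert_pair_cat; split=> //.
exact/IHn.
Qed.

Lemma avoiders_uniq t n : uniq (avoiders t n).
Proof.
elim: n => [|n IHn] //=; apply: allpairs_uniq_dep => // [w _|].
  exact/le_pairs_uniq/gaps_uniq.
have fresh w : w \in avoiders t n -> n.+1 \notin w.
  by case/mem_avoiders => can _; rewrite (mem_canonical_word _ can) ltnn andbF.
move=> _ _ /allpairsPdep [v [[p q] [vA pq_v ->]]]
  /allpairsPdep [v' [[p' q'] [vA' pq_v' ->]]] /=.
move: pq_v pq_v'; rewrite !mem_le_pairs !mem_gaps.
case/and3P => _ /andP [_ qv] pq /and3P [_ /andP [_ qv'] pq'].
by case/insert_pair_inj; rewrite ?pq ?pq' ?fresh // => -> -> ->.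
Qed.

Lemma sum_avoiders t n (g : nat -> nat) :
  \sum_(w <- avoiders t n) g (size (gaps t w)) =
  \sum_(k < n.+1) raney (n - k) (2 * k) * g k.+1.
Proof.
elim: n g => [|n IHn] g.
  by rewrite big_seq1 big_ord1 mul1n gaps_nil.
rewrite big_allpairs_dep /= big_seq.
under eq_bigr => w wA.
  rewrite sum_size_gaps_insert; last first.
    by case/mem_avoiders: wA => /canonical_word_ltS.
  over.
rewrite -big_seq (IHn (fun K => \sum_(d < K) (K - d) * g d.+2)).
rewrite (sum_raney_triangle n (fun d => g d.+2)) [RHS]big_ord_recl muln0 subn0.
rewrite [raney n.+1 0]/= mul0n add0n; apply: eq_bigr => d _.
by rewrite lift0 subSS mulnS.
Qed.

Lemma size_avoiders t n : size (avoiders t n) = raney n 1.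
Proof.
rewrite -sum1_size (sum_avoiders t n (fun=> 1)) (raney_geometric n 0).
by apply: eq_bigr => k _; rewrite muln1.
Qed.

(** * Matchings and canonical words *)

Section Rank.

Variables (T : finType) (A : {set T}) (f : T -> nat).

Definition rank (x : T) : nat := #|[set y in A | f y <= f x]|.

Lemma leq_rank x y : x \in A -> (rank x <= rank y) = (f x <= f y).
Proof.
move=> Ax; apply/idP/idP => [|fxy]; last first.
  by apply/subset_leq_card/subsetP => z;
    rewrite !inE => /andP [-> /leq_trans ->].
apply: contraTT; rewrite -!ltnNge => fyx; apply/proper_card/properP; split.
  by apply/subsetP => z; rewrite !inE => /andP [-> /leq_trans ->] //;
    apply: ltnW.
by exists x; rewrite !inE Ax ?leqnn // -ltnNge.
Qed.

Hypothesis f_inj : {in A &, injective f}.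

Lemma rank_inj : {in A &, injective rank}.
Proof.
move=> x y Ax Ay e; apply: f_inj => //; apply/eqP.
by rewrite eqn_leq -!leq_rank // e leqnn.
Qed.

Lemma perm_rank : perm_eq [seq rank x | x <- enum A] (iota 1 #|A|).
Proof.
have ranks_uniq : uniq [seq rank x | x <- enum A].
  rewrite map_inj_in_uniq ?enum_uniq // => x y.
  by rewrite !mem_enum; apply: rank_inj.
have ranks_le : {subset [seq rank x | x <- enum A] <= iota 1 #|A|}.
  move=> k /mapP [x]; rewrite mem_enum => Ax ->; rewrite mem_iota add1n ltnS.
  apply/andP; split; first by apply/card_gt0P; exists x; rewrite inE Ax leqnn.
  by apply/subset_leq_card/subsetP => y; rewrite inE => /andP [].
apply: uniq_perm; rewrite ?iota_uniq //.
by have [] := uniq_min_size ranks_uniq ranks_le;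
  rewrite // size_map size_iota cardE.
Qed.

End Rank.

Lemma set_min_le m (B : {set 'I_m}) i : i \in B -> set_min B <= i.
Proof.
by move=> iB; rewrite /set_min -minEnat -leEnat; apply: (bigmin_inf i).
Qed.

Lemma set_min_mem m (B : {set 'I_m}) :
  B != set0 -> exists2 i, i \in B & set_min B = i.
Proof.
case/set0Pn => i iB; rewrite /set_min -minEnat.
have [j _|j jB ->] := @eq_bigmin _ _ _ m i [in B] (@nat_of_ord m) iB;
  last by exists j.
exact/ltnW/ltn_ord.
Qed.

Lemma count_mem_card m (w : seq nat) a : size w = m ->
  count_mem a w = #|[set i : 'I_m | nth 0 w i == a]|.
Proof.
move=> szw; rewrite -sum1_count (big_nth 0) szw big_mkord.
by rewrite -sum1_card; apply: eq_bigl => i; rewrite inE.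
Qed.

Section CanonicalForm.

Variables (n : nat) (M : {set {set 'I_(2 * n)}}).
Hypothesis matching_M : is_matching M.

Lemma matching_partition : partition M [set: 'I_(2 * n)].
Proof. by case/andP: matching_M. Qed.

Lemma card_edge B : B \in M -> #|B| = 2.
Proof. by case/andP: matching_M => _ /forallP /(_ B) /implyP h /h /eqP. Qed.

Lemma card_matching : #|M| = n.
Proof.
have := card_uniform_partition card_edge matching_partition.
by rewrite cardsT card_ord; lia.
Qed.

Lemma pblock_edge i : pblock M i \in M.
Proof. by rewrite pblock_mem // (cover_partition matching_partition) inE. Qed.

Lemma mem_pblock_edge i : i \in pblock M i.
Proof. by rewrite mem_pblock (cover_partition matching_partition) inE. Qed.

Lemma edge_pblock B i : B \in M -> i \in B -> pblock M i = B.
Proof. by apply: def_pblock; case/and3P: matching_partition. Qed.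

Lemma edge_min B : B \in M -> exists2 i, i \in B & set_min B = i.
Proof. by move=> BM; apply: set_min_mem; rewrite -card_gt0 card_edge. Qed.

Lemma set_min_inj : {in M &, injective (@set_min (2 * n))}.
Proof.
move=> B B' BM BM'.
have [[i iB ->] [i' iB' ->]] := (edge_min BM, edge_min BM').
by move=> /val_inj e; rewrite -(edge_pblock BM iB) -(edge_pblock BM' iB') e.
Qed.

Lemma leq_edge_label B B' : B \in M ->
  (edge_label M B <= edge_label M B') = (set_min B <= set_min B').
Proof. exact: leq_rank. Qed.

Lemma edge_label_inj : {in M &, injective (edge_label M)}.
Proof. exact/rank_inj/set_min_inj. Qed.

Lemma mem_edge_labels a :
  reflect (exists2 B, B \in M & edge_label M B = a) (a \in iota 1 n).
Proof.
rewrite -[n in iota 1 n]card_matching -(perm_mem (perm_rank set_min_inj)).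
apply: (iffP mapP) => -[B BM Ba]; exists B => //; last by rewrite mem_enum.
by rewrite mem_enum in BM.
Qed.

Lemma size_canonical_form : size (canonical_form M) = 2 * n.
Proof. by rewrite size_map size_enum_ord. Qed.

Lemma nth_canonical_form (i : 'I_(2 * n)) :
  nth 0 (canonical_form M) i = edge_label M (pblock M i).
Proof. by rewrite (nth_map i) ?size_enum_ord // nth_ord_enum. Qed.

Lemma eq_canonical_form (i j : 'I_(2 * n)) :
  (nth 0 (canonical_form M) i == nth 0 (canonical_form M) j) =
  (pblock M i == pblock M j).
Proof.
by rewrite !nth_canonical_form (inj_in_eq edge_label_inj) ?pblock_edge.
Qed.

Lemma perm_canonical_form : perm_eq (canonical_form M) (iota 1 n ++ iota 1 n).
Proof.
apply/allP => a _; apply/eqP;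
  rewrite count_cat !(count_uniq_mem _ (iota_uniq _ _)).
case: (mem_edge_labels a) => [[B BM <-]|no_edge]; last first.
  apply/count_memPn/mapP => -[i _ ai]; apply: no_edge.
  by exists (pblock M i); rewrite ?pblock_edge.
rewrite (count_mem_card _ size_canonical_form) -[RHS](card_edge BM).
apply: eq_card => i; rewrite inE nth_canonical_form.
rewrite (inj_in_eq edge_label_inj) ?pblock_edge //.
by apply/eqP/idP => [<-|/(edge_pblock BM) //]; apply: mem_pblock_edge.
Qed.

Lemma restricted_growth_canonical_form : restricted_growth (canonical_form M).
Proof.
move=> i a /andP [a_gt0 a_lt].
have i_lt : i < 2 * n.
  rewrite ltnNge; apply/negP => i_ge.
  by rewrite nth_default ?size_canonical_form in a_lt.
rewrite (nth_canonical_form (Ordinal i_lt)) in a_lt.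
have label_le : edge_label M (pblock M (Ordinal i_lt)) \in iota 1 n.
  by apply/mem_edge_labels; exists (pblock M (Ordinal i_lt));
    rewrite ?pblock_edge.
have /mem_edge_labels [B BM Ba] : a \in iota 1 n.
  by move: label_le; rewrite !mem_iota; lia.
have [j jB Bj] := edge_min BM.
have ji : j < i.
  move: a_lt; rewrite -Ba ltnNge leq_edge_label ?pblock_edge // -ltnNge Bj.
  by move/leq_trans; apply;
    apply: (set_min_le (mem_pblock_edge (Ordinal i_lt))).
have <- : nth 0 (take i (canonical_form M)) j = a.
  by rewrite nth_take // nth_canonical_form (edge_pblock BM jB).
by apply: mem_nth; rewrite size_takel ?size_canonical_form // ltnW.
Qed.

Lemma canonical_form_word : canonical_word n (canonical_form M).
Proof. exact: (conj perm_canonical_form restricted_growth_canonical_form). Qed.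

Lemma matching_of_canonical_form :
  M = preim_partition (fun i : 'I_(2 * n) => nth 0 (canonical_form M) i) setT.
Proof.
rewrite -{1}(preim_partition_pblock matching_partition).
rewrite /preim_partition /equivalence_partition; apply: eq_imset => i.
by apply/setP => j; rewrite !inE eq_canonical_form.
Qed.

End CanonicalForm.

Lemma restricted_growth_nth_leq w w' i : restricted_growth w' ->
    0 < nth 0 w i -> i < size w ->
    (forall j, j < i -> nth 0 w j = nth 0 w' j) ->
    (forall j, j < i ->
       (nth 0 w i == nth 0 w j) = (nth 0 w' i == nth 0 w' j)) ->
  nth 0 w' i <= nth 0 w i.
Proof.
move=> grow' w_gt0 iw agree ker; rewrite leqNgt; apply/negP => lt.
have /(nthP 0) [j] := grow' i (nth 0 w i) (introT andP (conj w_gt0 lt)).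
rewrite size_take => j_lt wj.
have ji : j < i by move: j_lt; case: ifP => //; lia.
have := ker j ji; rewrite (agree j ji) -wj nth_take // eqxx => /esym /eqP e.
by rewrite e -wj nth_take // ltnn in lt.
Qed.

Lemma restricted_growth_kernel_inj w w' : 0 \notin w -> 0 \notin w' ->
    restricted_growth w -> restricted_growth w' -> size w = size w' ->
    (forall i j, i < size w -> j < size w ->
       (nth 0 w i == nth 0 w j) = (nth 0 w' i == nth 0 w' j)) ->
  w = w'.
Proof.
move=> w_pos w'_pos grow grow' sz ker; apply: (@eq_from_nth _ 0) => // i.
have pos v k : 0 \notin v -> k < size v -> 0 < nth 0 v k.
  by move=> v_pos kv; rewrite lt0n; apply: contraNneq v_pos => <-;
    apply: mem_nth.
elim/ltn_ind: i => i IHi iw.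
have agree j : j < i -> nth 0 w j = nth 0 w' j.
  by move=> ji; apply: IHi => //; apply: ltn_trans iw.
apply/eqP; rewrite eqn_leq !restricted_growth_nth_leq ?pos -?sz // => j ji.
- by rewrite ker // (ltn_trans ji).
- by rewrite agree.
by rewrite ker // (ltn_trans ji).
Qed.

Lemma canonical_word_matching n w : canonical_word n w ->
  exists2 M : {set {set 'I_(2 * n)}}, is_matching M & canonical_form M = w.
Proof.
move=> can; have szw := size_canonical_word can.
pose f (i : 'I_(2 * n)) := nth 0 w i.
have part := preim_partitionP f [set: 'I_(2 * n)].
have matchM : is_matching (preim_partition f setT).
  rewrite /is_matching part; apply/forallP => B;
    apply/implyP => /imsetP [i _ ->].
  have fi : 0 < f i <= n by rewrite -(mem_canonical_word _ can) mem_nth ?szw.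
  apply/eqP; transitivity (count_mem (f i) w); last first.
    by rewrite (count_canonical_word _ can) fi.
  by rewrite (count_mem_card _ szw); apply: eq_card => j; rewrite !inE eq_sym.
have canM := canonical_form_word matchM.
exists (preim_partition f setT) => //.
have pos v : canonical_word n v -> 0 \notin v by move/(mem_canonical_word 0)->.
apply: (restricted_growth_kernel_inj (pos _ canM) (pos _ can) canM.2 can.2).
  by rewrite szw size_canonical_form.
move=> i j; rewrite size_canonical_form => iw jw.
rewrite (eq_canonical_form matchM (Ordinal iw) (Ordinal jw)) eq_pblock.
- apply: pblock_equivalence_partition; rewrite ?inE //.
  by move=> k l m _ _ _; split=> // /eqP ->.
- by case/and3P: part.
by rewrite (cover_partition part) inE.
Qed.

Lemma card_avoiding_matchings t n :
  #|avoiding_matchings n (pattern_word t)| = raney n 1.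
Proof.
rewrite -(size_avoiders t) cardE -(size_map (@canonical_form (2 * n))).
apply/perm_size/uniq_perm.
- rewrite map_inj_in_uniq ?enum_uniq // => M M'; rewrite !mem_enum !inE.
  move=> /andP [mM _] /andP [mM' _] e.
  by rewrite (matching_of_canonical_form mM) e -matching_of_canonical_form.
- exact: avoiders_uniq.
move=> w; apply/mapP/idP => [[M]|].
  rewrite mem_enum inE => /andP [mM av] ->.
  by apply/mem_avoiders; split=> //; apply: canonical_form_word.
case/mem_avoiders => /canonical_word_matching [M mM <-] av.
by exists M => //; rewrite mem_enum inE mM.
Qed.

Theorem theorem6 (tau : seq nat) (n : nat) :
  tau \in [:: [:: 1; 2; 3; 1; 2]; [:: 1; 2; 1; 3; 2]; [:: 1; 2; 1; 2; 3];
              [:: 1; 2; 3; 2; 1]; [:: 1; 2; 2; 3; 1]; [:: 1; 2; 2; 1; 3]] ->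
  1 <= n ->
  (#|avoiding_matchings n tau|%:R = 1 / (2 * n + 1)%N%:R * 'C(3 * n, n)%:R :> rat)%R.
Proof.
move=> tau_in _; have [t ->] : exists t, tau = pattern_word t.
  move: tau_in; rewrite !inE.
  case/or4P => [/eqP ->|/eqP ->|/eqP ->|/or3P [] /eqP ->];
    [by exists P12312 | by exists P12132 | by exists P12123
    |by exists P12321 | by exists P12231 | by exists P12213].
rewrite card_avoiding_matchings -raney1_bin GRing.natrM GRing.mulrA.
rewrite GRing.mul1r GRing.mulVf ?GRing.mul1r //.
by rewrite Num.Theory.pnatr_eq0 addn1.
Qed.
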